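(* Let $k\ge 1$ and let $f:\{-1,1\}^n\to\{-1,1\}$ be computable by a read-$k$ decision tree. Let $\mathcal{X}\sim\widehat{f}^2$. Then $$\mathbf{H}[\mathcal{X}]\le 9k\cdot \mathbf{I}[f].$$
   Context: Write $f=\sum_{S\subseteq[n]}\widehat f(S)\chi_S$ with $\chi_S(x)=\prod_{i\in S}x_i$ (Fourier expansion under the uniform distribution on $\{-1,1\}^n$). Since $f$ is $\pm1$-valued, $\sum_S\widehat f(S)^2=1$; the spectral distribution $\widehat f^2$ is the distribution on subsets of $[n]$ with $\Pr[\mathcal{X}=S]=\widehat f(S)^2$, and $\mathbf{H}[\mathcal{X}]=\sum_S \widehat f(S)^2\log_2\frac{1}{\widehat f(S)^2}$ is its Shannon entropy. The total influence is $\mathbf{I}[f]=\sum_i \mathbf{I}_i[f]$, where $\mathbf{I}_i[f]=\Pr_x[f(x)\ne f(x^{\oplus i})]$ for uniform $x$ and $x^{\oplus i}$ is $x$ with the $i$-th bit flipped; equivalently $\mathbf{I}[f]=\sum_S|S|\widehat f(S)^2$. A decision tree is read-$k$ if no variable is queried at more than $k$ nodes of the tree. *)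

(* Defs.v *)
From HB Require Import structures.
From mathcomp Require Import all_boot all_order all_algebra.
From mathcomp Require Import reals exp.

Set Implicit Arguments.
Unset Strict Implicit.
Unset Printing Implicit Defensive.

Import Order.TTheory GRing.Theory Num.Theory.
Local Open Scope ring_scope.

(* The two-point set {-1,1} is encoded by bool: b stands for (-1)^b, so that
   false is 1 and true is -1.  This applies to the coordinates of points of the
   cube and to the values of Boolean functions. *)
Definition sgn (R : realType) (b : bool) : R := (-1) ^+ b.

Definition cube (n : nat) := {ffun 'I_n -> bool}.

Definition flip (n : nat) (i : 'I_n) (x : cube n) : cube n :=
  [ffun j => if j == i then ~~ x j else x j].

Definition chi (R : realType) (n : nat) (S : {set 'I_n}) (x : cube n) : R :=
  \prod_(i in S) sgn R (x i).

Definition fourier (R : realType) (n : nat) (f : cube n -> bool)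
    (S : {set 'I_n}) : R :=
  (\sum_(x : cube n) sgn R (f x) * chi R S x) / 2 ^+ n.

Definition spectral (R : realType) (n : nat) (f : cube n -> bool)
    (S : {set 'I_n}) : R :=
  fourier R f S ^+ 2.

Definition log2 (R : realType) (x : R) : R := ln x / ln 2.

(* Outcomes of probability 0 contribute 0, as usual. *)
Definition entropy (R : realType) (T : finType) (p : T -> R) : R :=
  \sum_(a : T) p a * log2 (1 / p a).

Definition influence (R : realType) (n : nat) (f : cube n -> bool)
    (i : 'I_n) : R :=
  #|[set x : cube n | f x != f (flip i x)]|%:R / 2 ^+ n.

Definition total_influence (R : realType) (n : nat) (f : cube n -> bool) : R :=
  \sum_(i < n) influence R f i.

(* At Query i t0 t1 the computation continues in t0 if the i-th coordinate is
   1 and in t1 if it is -1. *)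
Inductive dtree (n : nat) : Type :=
  | Leaf (b : bool)
  | Query (i : 'I_n) (t0 t1 : dtree n).

Fixpoint dtree_eval (n : nat) (t : dtree n) (x : cube n) : bool :=
  match t with
  | Leaf b => b
  | Query i t0 t1 => if x i then dtree_eval t1 x else dtree_eval t0 x
  end.

(* The number of nodes of the whole tree, not of a single path, that query i. *)
Fixpoint dtree_queries (n : nat) (t : dtree n) (i : 'I_n) : nat :=
  match t with
  | Leaf _ => 0
  | Query j t0 t1 => (j == i) + dtree_queries t0 i + dtree_queries t1 i
  end%N.

Definition read_k (k n : nat) (t : dtree n) : Prop :=
  forall i : 'I_n, (dtree_queries t i <= k)%N.

Definition read_k_computable (k n : nat) (f : cube n -> bool) : Prop :=
  exists2 t : dtree n, read_k k t & forall x : cube n, f x = dtree_eval t x.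

(* Main.v *)
Require Import Defs.
From HB Require Import structures.
From mathcomp Require Import all_boot all_order all_algebra.
From mathcomp Require Import boolp reals sequences exp.
From mathcomp Require Import ring lra.

Set Implicit Arguments.
Unset Strict Implicit.
Unset Printing Implicit Defensive.

Import Order.TTheory GRing.Theory Num.Theory.
Local Open Scope ring_scope.

(* If the root of the tree queries [i], then [f] equals [f0] or [f1] according
   to [x i], where [f0], [f1] do not depend on [i].  For [S] not containing [i]
   the Fourier coefficients of [f] at [S] and [i |: S] are [u = (a + b) / 2] and
   [w = (a - b) / 2], where [a], [b] are those of [f0], [f1] at [S].  So the
   entropy of [f] exceeds the average of the entropies of [f0] and [f1] by a sum
   over [S] of a cost that depends only on [a] and [b], and this cost is
   - [O(w^2)] if [a = 0] or [b = 0], and the [w^2] sum up to [Inf_i f];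
   - [O(w^2 + Inf_i f)] for [S] empty, because there [|w| <= Inf_i f];
   - [O(w^2 + u^2)] always; this is used for nonempty [S] all of whose variables
     are queried on both sides of the root, and is paid for by their influence.
   Hence in nats the entropy is at most [6 \sum_j q_j Inf_j f], where [q_j] is
   the number of nodes querying [j]: the last charge to [j] occurs only at nodes
   where the [q_j] queries split into two nonempty groups.  Finally
   [6 <= 9 ln 2]. *)

(** * Inequalities for a single term of the entropy, in nats *)

Definition ent (R : realType) (x : R) : R := - (x * ln x).

Section EntropyTerm.
Variable R : realType.
Implicit Types x y a b d : R.

Lemma ent0 : ent (0 : R) = 0.
Proof. by rewrite /ent mul0r oppr0. Qed.

(** This is [ln z <= z - 1] at [z = y / x], multiplied by [x]; at [x = 0] the left side vanishes. *)
Lemma mul_lnB_le x y : 0 <= x -> 0 < y -> x * (ln y - ln x) <= y - x.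
Proof.
rewrite le_eqVlt => /predU1P[<- y0|x0 y0]; first by rewrite mul0r subr0 ltW.
rewrite -ln_div ?posrE//.
have yx0 : 0 < y / x by rewrite divr_gt0.
have: ln (y / x) <= y / x - 1.
  have := @le_ln1Dx R (y / x - 1); rewrite addrCA subrr addr0; apply; lra.
rewrite -(ler_pM2l x0) => /le_trans; apply.
by rewrite mulrBr mulrCA divff ?gt_eqF// !mulr1.
Qed.

(** Replacing [y] by [y / e] in [mul_lnB_le] cancels the term [- x] and leaves [y / e], and
    [e >= 2]. *)
Lemma mul_lnB_le_half x y : 0 <= x -> 0 < y -> x * (ln y - ln x) <= y / 2.
Proof.
move=> x0 y0; have e2 : 2 <= expR 1 :> R.
  by have := expR_ge1Dx (1 : R); lra.
have ye0 : 0 < y / expR 1 by rewrite divr_gt0 ?expR_gt0.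
have := mul_lnB_le x0 ye0; rewrite ln_div ?posrE ?expR_gt0// expRK.
have : y / expR 1 <= y / 2 by rewrite ler_pM2l// lef_pV2 ?posrE ?expR_gt0//; lra.
lra.
Qed.

(** For [s = |a|], [ent (s ^+ 2)] is [2 s] times [- s ln s], which is at most [1 / 2]. *)
Lemma ent_sqr_le a d : `|a| <= d -> ent (a ^+ 2) <= d.
Proof.
move=> ad; apply: le_trans ad; rewrite /ent -real_normK ?num_real//.
have := normr_ge0 a; move: `|a| => s; rewrite le_eqVlt => /predU1P[<-|s0].
  by rewrite expr0n mul0r oppr0.
have := mul_lnB_le_half (ltW s0) ltr01; rewrite ln1 lnXn// => h.
have := ler_wpM2l (ltW s0) h; rewrite -mulr_natr expr2; lra.
Qed.

Lemma ln2_ge : 2 / 3 <= ln (2 : R).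
Proof.
(* [1.05 ^ 14] is just below 2, and [ln (21 / 20) >= 1 / 21], so 14 copies give [2 / 3]. *)
have h : ln ((21 / 20) ^+ 14) <= ln (2 : R).
  by rewrite ler_ln ?posrE ?exprn_gt0//; lra.
apply: le_trans h; rewrite lnXn; last by lra.
have := @mul_lnB_le (21 / 20) 1; rewrite ln1 -mulr_natr; lra.
Qed.

Lemma ln2_le : ln (2 : R) <= 1.
Proof. by have := @mul_lnB_le 1 2; rewrite ln1; lra. Qed.

Lemma ent_half_sqr a :
  ent ((a / 2) ^+ 2) *+ 2 <= ent (a ^+ 2) / 2 + 4 * (a / 2) ^+ 2.
Proof.
have [->|a0] := eqVneq a 0; first by rewrite mul0r expr0n/= ent0; lra.
have a20 : 0 < a ^+ 2 by rewrite exprn_even_gt0.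
have four0 : 0 < 2 ^+ 2 :> R by rewrite exprn_gt0.
rewrite /ent expr_div_n ln_div ?posrE// [ln (2 ^+ 2)]lnXn//.
have := ler_wpM2l (ltW a20) ln2_le.
have -> : 2 ^+ 2 = 4 :> R by rewrite expr2; lra.
lra.
Qed.

(* With [p = u^2 + w^2 = (a^2 + b^2) / 2], the entropy gained is the
   information about which of [a], [b] was chosen, at most [4 u^2 w^2 / p] by
   the chi-square bound on relative entropy, plus [p] times the binary entropy
   of [w^2 / p]. *)
Lemma ent_split a b (u := (a + b) / 2) (w := (a - b) / 2)
    (p := (a ^+ 2 + b ^+ 2) / 2) : 0 < p ->
  ent (u ^+ 2) + ent (w ^+ 2) <= (ent (a ^+ 2) + ent (b ^+ 2)) / 2 +
    5 * w ^+ 2 + w ^+ 2 * (ln p - ln (w ^+ 2)).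
Proof.
move=> p0.
have pE : p = u ^+ 2 + w ^+ 2 by rewrite /p /u /w; field.
(* The [u] half of the binary entropy costs at most [p - u^2 = w^2]; with the [4 w^2] from [hab] and
   [hw] this makes the constant 5. *)
have hu := mul_lnB_le (sqr_ge0 u) p0.
have chi2 x : 0 <= x -> x * (ln x - ln p) <= x * (x / p - 1).
  rewrite le_eqVlt => /predU1P[<-|x0]; first by rewrite !mul0r.
  rewrite ler_pM2l//.
  have -> : x / p - 1 = (x - p) / p by rewrite mulrBl divff ?gt_eqF.
  by rewrite ler_pdivlMr// mulrC; exact: mul_lnB_le (ltW p0) x0.
have ha := chi2 _ (sqr_ge0 a); have hb := chi2 _ (sqr_ge0 b).
(* Here [a^2 - p = p - b^2 = 2 u w] and [a^2 - b^2 = 4 u w]. *)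
have hab : a ^+ 2 * (a ^+ 2 / p - 1) / 2 + b ^+ 2 * (b ^+ 2 / p - 1) / 2
         = 4 * w ^+ 2 * (u ^+ 2 / p).
  have p2 : a ^+ 2 + b ^+ 2 != 0 by move: p0; rewrite /p; lra.
  by rewrite /p /u /w; field.
have hw : w ^+ 2 * (u ^+ 2 / p) <= w ^+ 2.
  rewrite ler_piMr ?sqr_ge0// ler_pdivrMr// mul1r pE lerDl sqr_ge0 //.
have aE : (a ^+ 2 + b ^+ 2) * ln p = (u ^+ 2 + w ^+ 2) * ln p * 2.
  by rewrite -pE /p; field.
by rewrite /ent; clearbody u w p; lra.
Qed.

Lemma ent_split_shared a b (u := (a + b) / 2) (w := (a - b) / 2) :
  ent (u ^+ 2) + ent (w ^+ 2) <= (ent (a ^+ 2) + ent (b ^+ 2)) / 2 +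
    5 * w ^+ 2 + (u ^+ 2 + w ^+ 2) / 2.
Proof.
have pE : (a ^+ 2 + b ^+ 2) / 2 = u ^+ 2 + w ^+ 2 by rewrite /u /w; field.
have [p0|p0] := ltP 0 ((a ^+ 2 + b ^+ 2) / 2).
  have := ent_split p0; have := mul_lnB_le_half (sqr_ge0 w) p0.
  rewrite -/u -/w -pE; lra.
have a0 : a ^+ 2 = 0 by have := sqr_ge0 a; have := sqr_ge0 b; lra.
have b0 : b ^+ 2 = 0 by have := sqr_ge0 a; have := sqr_ge0 b; lra.
have u0 : u ^+ 2 = 0 by have := sqr_ge0 u; have := sqr_ge0 w; lra.
have w0 : w ^+ 2 = 0 by have := sqr_ge0 u; have := sqr_ge0 w; lra.
by rewrite a0 b0 u0 w0 ent0; lra.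
Qed.

(** As [p <= 1], the last term of [ent_split] is at most [ent (w ^+ 2)], hence at most [d]. *)
Lemma ent_split_small a b d (u := (a + b) / 2) (w := (a - b) / 2) :
  `|a| <= 1 -> `|b| <= 1 -> `|w| <= d ->
  ent (u ^+ 2) + ent (w ^+ 2) <= (ent (a ^+ 2) + ent (b ^+ 2)) / 2 +
    5 * w ^+ 2 + d.
Proof.
move=> a1 b1 wd.
have d0 : 0 <= d by apply: le_trans wd.
have [p0|p0] := ltP 0 ((a ^+ 2 + b ^+ 2) / 2).
  have /ln_le0 p1 : (a ^+ 2 + b ^+ 2) / 2 <= 1.
    have sqr_le1 y : `|y| <= 1 -> y ^+ 2 <= 1.
      by move=> y1; rewrite -real_normK ?num_real// exprn_ile1.
    by have := sqr_le1 _ a1; have := sqr_le1 _ b1; lra.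
  have := ent_split p0; rewrite -/u -/w => /le_trans; apply.
  rewrite lerD2l; apply: le_trans (ent_sqr_le wd).
  by rewrite /ent mulrBr gerDr mulr_ge0_le0 ?sqr_ge0.
have /= := ent_split_shared a b; rewrite -/u -/w.
have -> : u ^+ 2 + w ^+ 2 = (a ^+ 2 + b ^+ 2) / 2 by rewrite /u /w; field.
lra.
Qed.

(** Here [u^2 = w^2], so [ent_half_sqr] gives even [4 w^2]; 5 matches the other two cases. *)
Lemma ent_split_disjoint a b (u := (a + b) / 2) (w := (a - b) / 2) :
  (a == 0) || (b == 0) ->
  ent (u ^+ 2) + ent (w ^+ 2) <= (ent (a ^+ 2) + ent (b ^+ 2)) / 2 +
    5 * w ^+ 2.
Proof.
rewrite /u /w => /orP[/eqP->|/eqP->].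
  rewrite add0r sub0r mulNr sqrrN expr0n/= ent0 add0r -mulr2n.
  have := ent_half_sqr b; have := sqr_ge0 (b / 2); lra.
rewrite addr0 subr0 expr0n/= ent0 addr0 -mulr2n.
have := ent_half_sqr a; have := sqr_ge0 (a / 2); lra.
Qed.

End EntropyTerm.

(** * Fourier analysis on the cube *)

Section Fourier.
Variables (R : realType) (n : nat).
Implicit Types (i j : 'I_n) (S : {set 'I_n}) (x y : cube n) (f : cube n -> bool).

Lemma flipK i : involutive (@flip n i).
Proof. by move=> x; apply/ffunP => j; rewrite !ffunE; case: eqP; rewrite ?negbK. Qed.

Lemma sgnN b : sgn R (~~ b) = - sgn R b.
Proof. by case: b; rewrite /sgn /= expr0 expr1 ?opprK. Qed.

Lemma sgn_sqr b : sgn R b * sgn R b = 1.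
Proof. by case: b; rewrite /sgn /= ?expr0 ?expr1 ?mulrNN mulr1. Qed.

Lemma normr_sgn b : `|sgn R b| = 1.
Proof. by case: b; rewrite /sgn /= ?expr0 ?expr1 ?normrN normr1. Qed.

Lemma normr_chi S x : `|chi R S x| = 1.
Proof. by rewrite normr_prod big1// => i _; exact: normr_sgn. Qed.

Lemma chiU1 i S x : i \notin S -> chi R (i |: S) x = sgn R (x i) * chi R S x.
Proof. exact: big_setU1. Qed.

Lemma chi_flip_notin i S x : i \notin S -> chi R S (flip i x) = chi R S x.
Proof.
move=> iS; apply: eq_bigr => j jS; rewrite ffunE ifN//.
by apply: contraNneq iS => <-.
Qed.

Lemma chi_flip_in i S x : i \in S -> chi R S (flip i x) = - chi R S x.
Proof.
move=> iS; rewrite -(setD1K iS) !chiU1 ?setD11// chi_flip_notin ?setD11//.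
by rewrite ffunE eqxx sgnN mulNr.
Qed.

(** The sum over [S] factors over coordinates, and a coordinate where [x] and [y] differ contributes
    a factor 0. *)
Lemma sum_chi x y : \sum_S chi R S x * chi R S y = 2 ^+ n * (x == y)%:R.
Proof.
transitivity (\prod_(i < n) (sgn R (x i) * sgn R (y i) + 1)).
  rewrite bigA_distr; apply: eq_bigr => S _.
  by rewrite -big_split/= big_mkcond.
have [<-|xy] := eqVneq x y.
  under eq_bigr do rewrite sgn_sqr.
  by rewrite prodr_const card_ord mulr1.
have [i xyi] : exists i, x i != y i.
  apply/existsP; apply: contraNT xy; rewrite negb_exists => /forallP h.
  by apply/eqP/ffunP => i; apply/eqP; rewrite -[_ == _]negbK.
rewrite mulr0 (bigD1 i)//=.
have -> : y i = ~~ x i by move: xyi; case: (x i) (y i) => [] [].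
by rewrite sgnN mulrN sgn_sqr addNr mul0r.
Qed.

Lemma parseval (g : cube n -> R) :
  \sum_S (\sum_x g x * chi R S x) ^+ 2 = 2 ^+ n * \sum_x g x ^+ 2.
Proof.
under eq_bigr => S _ do rewrite expr2 big_distrlr/=.
rewrite exchange_big mulr_sumr; apply: eq_bigr => x _ /=.
rewrite exchange_big (bigD1 x)//= [X in _ + X]big1 ?addr0 => [|y yx].
  under eq_bigr do rewrite mulrACA.
  by rewrite -mulr_sumr sum_chi eqxx mulr1 mulrC expr2.
under eq_bigr do rewrite mulrACA.
by rewrite -mulr_sumr sum_chi eq_sym (negPf yx) !mulr0.
Qed.

(** The coordinate Laplacian of [f]: it takes values in -1, 0, 1 and keeps exactly the frequencies
    containing [i]. *)
Definition half_diff f i x : R := (sgn R (f x) - sgn R (f (flip i x))) / 2.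

Lemma half_diff_norm f i x : `|half_diff f i x| = (f x != f (flip i x))%:R.
Proof.
rewrite /half_diff /sgn; case: (f x) (f (flip i x)) => [] [] /=; rewrite ?expr0 ?expr1.
- by rewrite subrr mul0r normr0.
- by rewrite (_ : (-1 - 1) / 2 = -1) ?normrN1//; lra.
- by rewrite (_ : (1 - -1) / 2 = 1) ?normr1//; lra.
- by rewrite subrr mul0r normr0.
Qed.

Lemma fourier_half_diff f i S : \sum_x half_diff f i x * chi R S x =
  if i \in S then 2 ^+ n * fourier R f S else 0.
Proof.
have -> : \sum_x half_diff f i x * chi R S x =
    (\sum_x sgn R (f x) * chi R S x -
     \sum_x sgn R (f (flip i x)) * chi R S x) / 2.
  rewrite -sumrB mulr_suml; apply: eq_bigr => x _; rewrite /half_diff; ring.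
rewrite [X in _ - X](reindex_inj (inv_inj (flipK i)))/=.
under [X in _ - X]eq_bigr do rewrite flipK.
case: ifPn => iS.
  under [X in _ - X]eq_bigr do rewrite chi_flip_in// mulrN.
  rewrite sumrN /fourier [RHS]mulrC divfK ?expf_neq0 ?pnatr_eq0//.
  by rewrite opprK; field.
under [X in _ - X]eq_bigr do rewrite chi_flip_notin//.
by rewrite subrr mul0r.
Qed.

Lemma sum_half_diff_norm f i :
  \sum_x `|half_diff f i x| = 2 ^+ n * influence R f i.
Proof.
rewrite /influence [RHS]mulrC divfK ?expf_neq0 ?pnatr_eq0// -sum1dep_card natr_sum.
rewrite [RHS]big_mkcond.
by apply: eq_bigr => x _; rewrite half_diff_norm; case: ifP.
Qed.

(** Parseval for [half_diff], whose square equals its absolute value. *)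
Lemma influenceE f i : influence R f i = \sum_(S : {set 'I_n} | i \in S) spectral R f S.
Proof.
have n0 : 2 ^+ n != 0 :> R by rewrite expf_neq0 ?pnatr_eq0.
apply: (mulfI n0); apply: (mulfI n0); rewrite -sum_half_diff_norm.
have -> : \sum_x `|half_diff f i x| = \sum_x half_diff f i x ^+ 2.
  apply: eq_bigr => x _; rewrite -real_normK ?num_real// half_diff_norm.
  by case: (_ != _); rewrite ?expr1n ?expr0n.
rewrite -parseval mulrA mulr_sumr [RHS]big_mkcond; apply: eq_bigr => S _.
rewrite fourier_half_diff; case: ifP => _; last by rewrite expr0n.
by rewrite exprMn expr2.
Qed.

Lemma influence_ge0 f i : 0 <= influence R f i.
Proof. by rewrite /influence divr_ge0 ?exprn_ge0. Qed.

(** The coefficient is also that of [half_diff], so it is bounded by the mean of [|half_diff|]. *)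
Lemma fourier_le_influence f i S : i \in S -> `|fourier R f S| <= influence R f i.
Proof.
move=> iS; have n0 : 0 < 2 ^+ n :> R by rewrite exprn_gt0.
rewrite -(ler_pM2l n0) -sum_half_diff_norm -{1}(gtr0_norm n0) -normrM.
have := fourier_half_diff f i S; rewrite iS => <-.
apply: le_trans (ler_norm_sum _ _ _) _; apply: ler_sum => x _.
by rewrite normrM normr_chi mulr1.
Qed.

Lemma fourier_norm_le1 f S : `|fourier R f S| <= 1.
Proof.
have n0 : 0 < 2 ^+ n :> R by rewrite exprn_gt0.
rewrite /fourier normrM normfV (gtr0_norm n0).
rewrite ler_pdivrMr// mul1r; apply: le_trans (ler_norm_sum _ _ _) _.
under eq_bigr do rewrite normrM normr_chi mulr1 normr_sgn.
by rewrite sumr_const card_ffun card_bool card_ord natrX.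
Qed.

Definition indep f i := forall x, f (flip i x) = f x.

Lemma influence_indep f i : indep f i -> influence R f i = 0.
Proof.
move=> fi; rewrite /influence (_ : [set x | _] = set0) ?cards0 ?mul0r//.
by apply/setP => x; rewrite !inE fi eqxx.
Qed.

Lemma fourier_indep f i S : indep f i -> i \in S -> fourier R f S = 0.
Proof.
move=> /influence_indep fi /(fourier_le_influence f).
by rewrite fi normr_le0 => /eqP.
Qed.

Lemma sum_setU1 i (F : {set 'I_n} -> R) :
  \sum_S F S = \sum_(S : {set 'I_n} | i \notin S) (F S + F (i |: S)).
Proof.
rewrite (bigID (fun S : {set 'I_n} => i \notin S))/= big_split/=; congr (_ + _).
rewrite (reindex_onto (fun S => i |: S) (fun S => S :\ i))/=; last first.
  by move=> S; rewrite negbK => /setD1K.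
apply: eq_bigl => S; rewrite negbK setU11/=; apply/eqP/idP => [<-|iS].
  by rewrite setD11.
by rewrite setU1K.
Qed.

(** * Spectrum and entropy of a function split at one variable *)

Definition ln_entropy f := \sum_S ent (spectral R f S).

Definition branch i f0 f1 x : bool := if x i then f1 x else f0 x.

Section Branch.
Variables (i : 'I_n) (f0 f1 : cube n -> bool).
Hypotheses (f0i : indep f0 i) (f1i : indep f1 i).
Let f := branch i f0 f1.

(** With signs for bits, [f = (1 + x_i) / 2 * f0 + (1 - x_i) / 2 * f1], and multiplying by [x_i]
    exchanges the characters of [S] and [S']. *)
Let fourier_branch_gen S S' : (forall x, chi R S' x = sgn R (x i) * chi R S x) ->
  fourier R f S = (fourier R f0 S + fourier R f0 S'
                   + (fourier R f1 S - fourier R f1 S')) / 2.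
Proof.
move=> SS'; rewrite /fourier -!mulrDl -mulrBl -mulrDl mulrAC; congr (_ / _).
rewrite -sumrB -!big_split mulr_suml; apply: eq_bigr => x _ /=; rewrite SS'.
by rewrite /f /branch; case: (x i); rewrite /sgn/= ?expr0 ?expr1; field.
Qed.

Lemma fourier_branch S : i \notin S ->
  fourier R f S = (fourier R f0 S + fourier R f1 S) / 2.
Proof.
move=> iS; rewrite (@fourier_branch_gen S (i |: S)) => [|x]; last exact: chiU1.
by rewrite !(@fourier_indep _ i (i |: S)) ?setU11// addr0 subr0.
Qed.

Lemma fourier_branchU1 S : i \notin S ->
  fourier R f (i |: S) = (fourier R f0 S - fourier R f1 S) / 2.
Proof.
move=> iS; rewrite (@fourier_branch_gen (i |: S) S) => [|x].
  by rewrite !(@fourier_indep _ i (i |: S)) ?setU11// add0r sub0r.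
by rewrite chiU1// mulrA sgn_sqr mul1r.
Qed.

Lemma influence_branch_root :
  influence R f i = \sum_(S : {set 'I_n} | i \notin S) spectral R f (i |: S).
Proof.
rewrite influenceE big_mkcond (sum_setU1 i); apply: eq_bigr => S iS.
by rewrite (negPf iS) setU11 add0r.
Qed.

Lemma influence_branch j : j != i ->
  influence R f j = (influence R f0 j + influence R f1 j) / 2.
Proof.
move=> ji; rewrite !influenceE !(big_mkcond (fun S : {set 'I_n} => j \in S)).
rewrite !(sum_setU1 i) -big_split mulr_suml; apply: eq_bigr => S iS /=.
rewrite !inE (negPf ji)/=; case: (j \in S); last by rewrite !addr0 mul0r.
rewrite /spectral fourier_branch// fourier_branchU1//.
by rewrite !(@fourier_indep _ i (i |: S)) ?setU11//; field.
Qed.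

(* The nonempty sets [S] contained in [J] are charged to the influences of the
   variables of [J]; for all other nonempty [S] one branch has no mass. *)
Lemma ln_entropy_branch (J : {set 'I_n}) : i \notin J ->
  (forall j, j \notin J -> indep f0 j \/ indep f1 j) ->
  ln_entropy f <= (ln_entropy f0 + ln_entropy f1) / 2 +
    6 * influence R f i + (\sum_(j in J) influence R f j) / 2.
Proof.
move=> iJ J0; pose a S := fourier R f0 S; pose b S := fourier R f1 S.
have halfE : (ln_entropy f0 + ln_entropy f1) / 2 =
    \sum_(S : {set 'I_n} | i \notin S) (ent (a S ^+ 2) + ent (b S ^+ 2)) / 2.
  rewrite /ln_entropy !(sum_setU1 i) -big_split mulr_suml.
  apply: eq_bigr => S iS /=; rewrite /spectral.
  by rewrite !(@fourier_indep _ i (i |: S)) ?setU11// expr0n/= ent0 !addr0.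
have JE : (\sum_(j in J) influence R f j) / 2 =
    \sum_(S : {set 'I_n} | i \notin S) (\sum_(j in J | j \in S)
       (spectral R f S + spectral R f (i |: S))) / 2.
  under eq_bigr do rewrite influenceE big_mkcond (sum_setU1 i).
  rewrite exchange_big mulr_suml; apply: eq_bigr => S iS /=.
  rewrite [in RHS]big_mkcondr/=; congr (_ / _); apply: eq_bigr => j jJ.
  have /negPf ji : j != i by apply: contraNneq iJ => <-.
  by rewrite !inE ji; case: (j \in S); rewrite ?addr0.
(* Five of the six units pay for the [w^2] of all pairs, the sixth for the pair of the empty set. *)
have infE : 6 * influence R f i = \sum_(S : {set 'I_n} | i \notin S)
    (5 * spectral R f (i |: S) + (if S == set0 then influence R f i else 0)).
  rewrite big_split -big_mkcondr (big_pred1 set0) => [|S]; last first.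
    by rewrite /=; case: eqP => [->|]; rewrite ?inE ?andbF.
  by rewrite -mulr_sumr -influence_branch_root /=; ring.
rewrite halfE infE JE -!big_split /ln_entropy (sum_setU1 i).
apply: ler_sum => S iS /=.
rewrite /spectral fourier_branch// fourier_branchU1// -/(a S) -/(b S).
case: eqP => [S0|/eqP S0].
  rewrite [X in _ + X / 2]big1 => [|j]; last by rewrite S0 inE andbF.
  rewrite mul0r addr0 addrA; apply: ent_split_small; rewrite ?fourier_norm_le1//.
  by rewrite -fourier_branchU1// fourier_le_influence// setU11.
rewrite addr0; have [SJ|] := boolP (S \subset J).
  apply: le_trans (ent_split_shared _ _) _; rewrite lerD2l ler_pM2r ?invr_gt0//.
  (* The charge to a single [j] in [S] already covers the excess. *)
  have [j jS] := set0Pn _ S0; rewrite (bigD1 j)/=; last first.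
    by rewrite jS (subsetP SJ).
  by rewrite lerDl; apply: sumr_ge0 => *; rewrite addr_ge0 ?sqr_ge0.
move=> /subsetPn[j jS jJ].
apply: le_trans (ent_split_disjoint _) _; last first.
  rewrite lerDl; apply: divr_ge0 => //.
  by apply: sumr_ge0 => *; rewrite addr_ge0 ?sqr_ge0.
by case: (J0 j jJ) => /fourier_indep fj; rewrite /a /b fj ?eqxx ?orbT.
Qed.

End Branch.
End Fourier.

(** * Pruned decision trees and the induction over them *)

(** Below a root querying [i], later queries of [i] have known answers; removing them makes both
    branches independent of [i]. *)
Fixpoint prune n (i : 'I_n) (b : bool) (t : dtree n) : dtree n :=
  match t with
  | Leaf c => Leaf n c
  | Query j t0 t1 =>
    if j == i then (if b then prune i b t1 else prune i b t0)
    else Query j (prune i b t0) (prune i b t1)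
  end.

(** The induction measure, since pruned subtrees are not structural subterms. *)
Fixpoint dtree_size n (t : dtree n) : nat :=
  match t with
  | Leaf _ => 0
  | Query _ t0 t1 => (dtree_size t0 + dtree_size t1).+1
  end.

Section Tree.
Variable n : nat.
Implicit Types (i j : 'I_n) (t : dtree n) (x : cube n).

Lemma prune_eval i b t x : x i = b -> dtree_eval (prune i b t) x = dtree_eval t x.
Proof.
move=> xi; elim: t => //= j t0 IH0 t1 IH1.
by case: eqP => [->|_]/=; rewrite ?xi -?IH0 -?IH1; case: b {xi IH0 IH1}.
Qed.

Lemma prune_size i b t : (dtree_size (prune i b t) <= dtree_size t)%N.
Proof.
elim: t => //= j t0 IH0 t1 IH1; case: eqP => _ /=; last by rewrite ltnS leq_add.
case: b IH0 IH1 => h0 h1; apply: leqW.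
  exact: leq_trans h1 (leq_addl _ _).
exact: leq_trans h0 (leq_addr _ _).
Qed.

Lemma prune_queries i b t j :
  (dtree_queries (prune i b t) j <= dtree_queries t j)%N.
Proof.
elim: t => //= l t0 IH0 t1 IH1; case: eqP => _ /=; last by rewrite !leq_add.
case: b IH0 IH1 => h0 h1; first exact: leq_trans h1 (leq_addl _ _).
by apply: leq_trans h0 _; rewrite -addnA addnCA leq_addr.
Qed.

Lemma prune_queries0 i b t : dtree_queries (prune i b t) i = 0%N.
Proof.
elim: t => //= j t0 IH0 t1 IH1; case: eqVneq => [_|/negPf ji] /=.
  by case: b IH0 IH1.
by rewrite ji IH0 IH1.
Qed.

Lemma dtree_indep t i : dtree_queries t i = 0%N -> indep (dtree_eval t) i.
Proof.
move=> + x; elim: t => //= j t0 IH0 t1 IH1 /eqP.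
rewrite !addn_eq0 eqb0 -andbA => /and3P[ji /eqP/IH0-> /eqP/IH1->].
by rewrite ffunE (negPf ji).
Qed.

(** The spectral distribution of a constant has all its mass on the empty set. *)
Lemma ln_entropy_leaf (R : realType) b : ln_entropy R (dtree_eval (Leaf n b)) = 0.
Proof.
rewrite /ln_entropy big1// => S _; have [->|[i iS]] := set_0Vmem S; last first.
  by rewrite /spectral (@fourier_indep _ _ _ i)// expr0n ent0.
rewrite /spectral /fourier /= -mulr_sumr.
under eq_bigr do rewrite /chi big_set0.
rewrite sumr_const card_ffun card_bool card_ord natrX mulfK ?expf_neq0 ?pnatr_eq0//.
by rewrite expr2 sgn_sqr /ent ln1 mulr0 oppr0.
Qed.

Lemma ln_entropy_dtree (R : realType) t : ln_entropy R (dtree_eval t) <=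
  6 * \sum_(j < n) (dtree_queries t j)%:R * influence R (dtree_eval t) j.
Proof.
have [m] := ubnP (dtree_size t); elim: m t => // m IH [b _|i t0 t1].
  by rewrite ln_entropy_leaf mulr_ge0// sumr_ge0// => j _; rewrite mul0r.
rewrite /= ltnS => tm.
set p0 := prune i false t0; set p1 := prune i true t1.
have fE : dtree_eval (Query i t0 t1) = branch i (dtree_eval p0) (dtree_eval p1).
  by apply/funext => x /=; rewrite /branch; case: ifP => xi; rewrite prune_eval.
have p0i : dtree_queries p0 i = 0%N by exact: prune_queries0.
have p1i : dtree_queries p1 i = 0%N by exact: prune_queries0.
pose J := [set j | (0 < dtree_queries p0 j) && (0 < dtree_queries p1 j)]%N.
have iJ : i \notin J by rewrite inE p0i.
have J0 j : j \notin J -> indep (dtree_eval p0) j \/ indep (dtree_eval p1) j.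
  by rewrite inE negb_and -!eqn0Ngt => /orP[]/eqP/dtree_indep; [left|right].
have IH0 := IH p0
  (leq_ltn_trans (leq_trans (prune_size i false t0) (leq_addr _ _)) tm).
have IH1 := IH p1
  (leq_ltn_trans (leq_trans (prune_size i true t1) (leq_addl _ _)) tm).
have f0i := dtree_indep p0i; have f1i := dtree_indep p1i.
rewrite -/(dtree_eval (Query i t0 t1)) fE.
apply: le_trans (ln_entropy_branch R f0i f1i iJ J0) _.
set f := branch _ _ _; pose I0 := influence R (dtree_eval p0).
pose I1 := influence R (dtree_eval p1).
pose Q0 j : R := (dtree_queries p0 j)%:R; pose Q1 j : R := (dtree_queries p1 j)%:R.
(* Accounting for one variable: averaging the two induction hypotheses turns 6 into 3 per branch,
   and the root adds the other two charges. *)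
have node j : 3 * (Q0 j * I0 j) + 3 * (Q1 j * I1 j) +
    (if j == i then 6 * influence R f i else 0) +
    (if j \in J then influence R f j / 2 else 0) <=
    6 * (((i == j) + dtree_queries t0 j + dtree_queries t1 j)%:R * influence R f j).
  have [->|ji] := eqVneq j i.
    rewrite (negPf iJ) /Q0 /Q1 p0i p1i !mul0r !mulr0 !add0r addr0 ler_pM2l//.
    by rewrite ler_peMl ?influence_ge0// -addnA ler1n.
  rewrite add0n addr0 influence_branch// -/(I0 j) -/(I1 j).
  have I0_ge0 : 0 <= I0 j by exact: influence_ge0.
  have I1_ge0 : 0 <= I1 j by exact: influence_ge0.
  have le_Q : Q0 j + Q1 j <= (dtree_queries t0 j + dtree_queries t1 j)%:R.
    by rewrite -natrD ler_nat leq_add ?prune_queries.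
  have I_ge0 : 0 <= (I0 j + I1 j) / 2 by rewrite divr_ge0 ?addr_ge0.
  have := ler_wpM2r I_ge0 le_Q.
  have [|_] := boolP (j \in J).
    rewrite inE -!(ler1n R) -/(Q0 j) -/(Q1 j) => /andP[q0 q1].
    (* As both counts are at least 1, the cross terms [Q0 j * I1 j] and [Q1 j * I0 j] are at least
       [I1 j] and [I0 j], which covers the extra [(I0 j + I1 j) / 4]. *)
    have := ler_wpM2r I1_ge0 q0; have := ler_wpM2r I0_ge0 q1; lra.
  have Q0_ge0 : 0 <= Q0 j by exact: ler0n.
  have Q1_ge0 : 0 <= Q1 j by exact: ler0n.
  have := mulr_ge0 Q0_ge0 I1_ge0; have := mulr_ge0 Q1_ge0 I0_ge0; lra.
have sum_node := ler_sum (index_enum _) (P := xpredT) (fun j _ => node j).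
rewrite !big_split -!mulr_sumr -!big_mkcond big_pred1_eq in sum_node.
by move: IH0 IH1 sum_node; rewrite /I0 /I1 /Q0 /Q1 mulr_suml /=; lra.
Qed.

End Tree.

(** * From nats to bits, and from query counts to [k] *)

Theorem theorem1p1 (R : realType) (k n : nat) (f : cube n -> bool)
    (hk : (1 <= k)%N) (hf : read_k_computable k f) :
  entropy (spectral R f) <= 9 * k%:R * total_influence R f.
Proof.
have [t tk /funext ->] := hf; set g := dtree_eval t.
have ln2 := ln2_ge R; have ln2_gt0 : 0 < ln (2 : R) by lra.
have -> : entropy (spectral R g) = ln_entropy R g / ln 2.
  rewrite /entropy /ln_entropy mulr_suml; apply: eq_bigr => S _.
  have [->|p0] := eqVneq (spectral R g S) 0; first by rewrite ent0 !mul0r.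
  by rewrite /log2 /ent div1r lnV ?posrE ?lt0r ?p0 ?sqr_ge0// mulrA mulrN.
rewrite ler_pdivrMr//; apply: le_trans (ln_entropy_dtree R t) _.
have I0 : 0 <= total_influence R g by apply: sumr_ge0 => i _; exact: influence_ge0.
have : \sum_j (dtree_queries t j)%:R * influence R g j <= k%:R * total_influence R g.
  rewrite /total_influence mulr_sumr; apply: ler_sum => i _.
  by rewrite ler_wpM2r ?influence_ge0// ler_nat tk.
(* The constant 9 comes from [6 <= 9 ln 2], that is [ln 2 >= 2 / 3]. *)
have := mulr_ge0 (mulr_ge0 (ler0n R k) I0) (_ : 0 <= ln 2 - 2 / 3).
rewrite subr_ge0 => /(_ ln2); lra.
Qed.
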